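(* Let $\mathsf{K}$ be a prevariety of (generalized) quantales and $\mathbf{M}$ a pomonoid, and suppose that the unit map $\eta_M\colon M\to F_{\mathsf{K}}(M)$ is an order-embedding. Then the forgetful functor (sending an $F_{\mathsf{K}}(\mathbf{M})$-module with action $\ast$ to the $\mathbf{M}$-act with action $a\star x=\eta_M(a)\ast x$, and acting as the identity on morphisms) is an isomorphism between the category of $F_{\mathsf{K}}(\mathbf{M})$-modules whose underlying (generalized) quantale lies in $\mathsf{K}$ and the category of $\mathbf{M}$-acts whose underlying (generalized) quantale lies in $\mathsf{K}$. In particular, each such $\mathbf{M}$-act can be uniquely expanded to an $F_{\mathsf{K}}(\mathbf{M})$-module.
   Context: Fix one of two parallel settings: plain (''joins'' = joins of arbitrary families) or generalized (''joins'' = joins of non-empty families). A (generalized) quantale is $\mathbf{Q}=\langle Q,\bigvee,+,\mathsf{0}\rangle$ with $Q$ a poset having all such joins, $\langle Q,+,\mathsf{0}\rangle$ a monoid with $+$ order-preserving and distributing over such joins on both sides; homomorphisms preserve such joins, $+$, $\mathsf{0}$. A (generalized) quantale term is a formal join of a (non-empty, in the generalized setting) set of terms built from variables, $+$ and $\mathsf{0}$. A prevariety is a class closed under isomorphic images, subalgebras and products. A pomonoid $\mathbf{M}$ is a monoid with a partial order making multiplication order-preserving. For a poset $X$, the $\mathsf{K}$-free (generalized) quantale $F_{\mathsf{K}}(X)\in\mathsf{K}$ comes with an order-preserving $\eta_X\colon X\to F_{\mathsf{K}}(X)$ such that each order-preserving $g\colon X\to\mathbf{Q}\in\mathsf{K}$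 equals $g^\sharp\circ\eta_X$ for a unique homomorphism $g^\sharp$. For the poset reduct $M$ of $\mathbf{M}$, $F_{\mathsf{K}}(M)$ carries a unique binary operation $\cdot$ such that for all terms $t$, all $\bar a, b\in F_{\mathsf{K}}(M)$, and $a,c\in M$: $t(\bar a)\cdot b=t(\bar a\cdot b)$, $\eta_M(a)\cdot t(\bar b)=t(\eta_M(a)\cdot\bar b)$, $\eta_M(a)\cdot\eta_M(c)=\eta_M(ac)$; with unit $\eta_M(1)$, and with $\mathbf{A}_{\mathrm{d}}:=\mathbf{M}$, $\iota:=\eta_M$, this yields the (generalized) additive quantale with multiplication $F_{\mathsf{K}}(\mathbf{M})=\langle\mathbf{M},F_{\mathsf{K}}(M),\eta_M\rangle$. For such a triple $\langle\mathbf{A}_{\mathrm d},\mathbf{A},\iota\rangle$, an $\mathbf{A}$-module is a (generalized) quantale $\mathbf{Q}$ with a map $\ast\colon A\times Q\to Q$, order-preserving in both coordinates, with $(a\cdot b)\ast x=a\ast(b\ast x)$, $\mathsf{1}\ast x=x$, $(a+b)\ast x=a\ast x+b\ast x$, $\mathsf{0}\ast x=\mathsf{0}$, $(\bigvee_i a_i)\ast x=\bigvee_i(a_i\ast x)$, and for $d\in\mathbf{A}_{\mathrm d}$ the map $x\mapsto\iota(d)\ast x$ preserves $+$, $\mathsf{0}$ and joins; module homomorphisms are quantale homomorphisms $f$ with $f(a\ast x)=a\ast f(x)$. An $\mathbf{M}$-act is a (generalized) quantale $\mathbf{L}$ with an action $\ast\colon M\times L\to L$, order-preserving in both coordinates,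 with $(ab)\ast x=a\ast(b\ast x)$, $1\ast x=x$, and each $x\mapsto a\ast x$ a (generalized) quantale endomorphism; morphisms are quantale homomorphisms commuting with the action. *)

(* Defs.v *)
From Stdlib Require Import Relations.
From Stdlib Require Import FunctionalExtensionality ProofIrrelevance ClassicalEpsilon.

Set Implicit Arguments.
Unset Strict Implicit.
Unset Printing Implicit Defensive.

Record poset := Poset {
  pcar :> Type;
  ple : relation pcar;
  ple_order : order pcar ple
}.

Definition order_preserving (X Y : poset) (f : X -> Y) : Prop :=
  forall x y : X, ple x y -> ple (f x) (f y).

Definition order_embedding (X Y : poset) (f : X -> Y) : Prop :=
  forall x y : X, ple x y <-> ple (f x) (f y).

Record pomonoid := Pomonoid {
  pm_poset :> poset;
  pm_mul : pm_poset -> pm_poset -> pm_poset;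
  pm_one : pm_poset;
  pm_mulA : forall a b c, pm_mul a (pm_mul b c) = pm_mul (pm_mul a b) c;
  pm_mul1l : forall a, pm_mul pm_one a = a;
  pm_mul1r : forall a, pm_mul a pm_one = a;
  pm_mul_mono : forall a a' b b',
    ple a a' -> ple b b' -> ple (pm_mul a b) (pm_mul a' b')
}.

Inductive setting := plain | generalized.

Definition admissible (s : setting) (X : Type) (S : X -> Prop) : Prop :=
  match s with plain => True | generalized => exists x, S x end.

(* The sets whose joins are considered: all sets in the plain setting, the
   non-empty ones in the generalized setting. *)
Record jset (s : setting) (X : Type) := JSet {
  jmem :> X -> Prop;
  jmem_adm : admissible s jmem
}.

Lemma admissible_image s X Y (f : X -> Y) (S : X -> Prop) :
  admissible s S -> admissible s (fun y => exists x, S x /\ y = f x).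
Proof.
destruct s; simpl; [trivial|].
intros [x Sx]. exists (f x). exists x. split; trivial.
Qed.

Definition jimage s X Y (f : X -> Y) (S : jset s X) : jset s Y :=
  JSet (admissible_image f (jmem_adm S)).

Definition is_lub (X : poset) (S : X -> Prop) (j : X) : Prop :=
  (forall x, S x -> ple x j) /\ (forall u, (forall x, S x -> ple x u) -> ple j u).

Record quantale (s : setting) := Quantale {
  q_poset :> poset;
  join : jset s q_poset -> q_poset;
  plus : q_poset -> q_poset -> q_poset;
  zero : q_poset;
  join_lub : forall S : jset s q_poset, is_lub S (join S);
  plusA : forall x y z, plus x (plus y z) = plus (plus x y) z;
  plus0l : forall x, plus zero x = x;
  plus0r : forall x, plus x zero = x;
  plus_mono : forall x x' y y',
    ple x x' -> ple y y' -> ple (plus x y) (plus x' y');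
  plus_joinl : forall (S : jset s q_poset) y,
    plus (join S) y = join (jimage (fun x => plus x y) S);
  plus_joinr : forall x (S : jset s q_poset),
    plus x (join S) = join (jimage (fun y => plus x y) S)
}.

Arguments zero {s} q.

Record is_qhom (s : setting) (P Q : quantale s) (f : P -> Q) : Prop := IsQHom {
  qhom_join : forall S : jset s P, f (join S) = join (jimage f S);
  qhom_plus : forall x y, f (plus x y) = plus (f x) (f y);
  qhom_zero : f (zero P) = zero Q
}.

Lemma ple_refl (X : poset) (x : X) : ple x x.
Proof. apply (ord_refl _ _ (ple_order X)). Qed.

Lemma ple_trans (X : poset) (x y z : X) : ple x y -> ple y z -> ple x z.
Proof. apply (ord_trans _ _ (ple_order X)). Qed.

Lemma ple_anti (X : poset) (x y : X) : ple x y -> ple y x -> x = y.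
Proof. apply (ord_antisym _ _ (ple_order X)). Qed.

Lemma is_lub_unique (X : poset) (S T : X -> Prop) j k :
  (forall x, S x <-> T x) -> is_lub S j -> is_lub T k -> j = k.
Proof.
intros E [u1 l1] [u2 l2]. apply ple_anti.
- apply l1. intros x Sx. apply u2, E, Sx.
- apply l2. intros x Tx. apply u1, E, Tx.
Qed.

Lemma join_unique s (Q : quantale s) (S : jset s Q) j : is_lub S j -> join S = j.
Proof. intros H. apply (is_lub_unique (S := S) (T := S)); [tauto | apply join_lub | exact H]. Qed.

Lemma join_ext s (Q : quantale s) (S T : jset s Q) :
  (forall x, S x <-> T x) -> join S = join T.
Proof. intros E. apply (is_lub_unique E); apply join_lub. Qed.

Lemma join_jimage_comp s X Y (Q : quantale s) (f : X -> Y) (g : Y -> Q)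
    (h : X -> Q) (S : jset s X) :
  (forall x, g (f x) = h x) -> join (jimage g (jimage f S)) = join (jimage h S).
Proof.
intros E. apply join_ext. intros z. simpl. split.
- intros [y [[x [Sx ->]] ->]]. exists x. rewrite E. auto.
- intros [x [Sx ->]]. exists (f x). rewrite E. split; eauto.
Qed.

Lemma is_qhom_id s (Q : quantale s) : is_qhom (fun x : Q => x).
Proof.
split; auto. intros S. apply join_ext. intros x. simpl. split; [eauto|].
intros [y [Sy ->]]. exact Sy.
Qed.

Lemma is_qhom_comp s (P Q R : quantale s) (f : P -> Q) (g : Q -> R) :
  is_qhom f -> is_qhom g -> is_qhom (fun x => g (f x)).
Proof.
intros Hf Hg. split.
- intros S. rewrite (qhom_join Hf), (qhom_join Hg).
  apply join_jimage_comp. reflexivity.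
- intros x y. rewrite (qhom_plus Hf), (qhom_plus Hg). reflexivity.
- rewrite (qhom_zero Hf), (qhom_zero Hg). reflexivity.
Qed.

Record subclosed (s : setting) (Q : quantale s) (B : Q -> Prop) : Prop := SubClosed {
  sub_join : forall S : jset s Q, (forall x, S x -> B x) -> B (join S);
  sub_plus : forall x y, B x -> B y -> B (plus x y);
  sub_zero : B (zero Q)
}.

Lemma sub_order (X : poset) (B : X -> Prop) :
  order {x : X | B x} (fun x y => ple (proj1_sig x) (proj1_sig y)).
Proof.
split.
- intros x. apply ple_refl.
- intros x y z. apply ple_trans.
- intros [x Bx] [y By]; simpl; intros xy yx.
  assert (E : x = y) by (apply ple_anti; assumption).
  subst y. f_equal. apply proof_irrelevance.
Qed.

Definition sub_poset (X : poset) (B : X -> Prop) : poset := Poset (sub_order B).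

Lemma sub_eq (X : poset) (B : X -> Prop) (x y : sub_poset B) :
  proj1_sig x = proj1_sig y -> x = y.
Proof.
intros E. apply (@ple_anti (sub_poset B)); simpl; rewrite E; apply ple_refl.
Qed.

Lemma sub_join_in s (Q : quantale s) (B : Q -> Prop) (HB : subclosed B)
    (S : jset s (sub_poset B)) :
  B (join (jimage (fun x : sub_poset B => proj1_sig x) S)).
Proof. apply (sub_join HB). intros x [[y By] [_ ->]]. exact By. Qed.

Definition subquantale s (Q : quantale s) (B : Q -> Prop) (HB : subclosed B) :
  quantale s.
Proof.
refine (@Quantale s (sub_poset B)
  (fun S => exist B _ (sub_join_in HB S))
  (fun x y => exist B (plus (proj1_sig x) (proj1_sig y))
                (sub_plus HB (proj2_sig x) (proj2_sig y)))
  (exist B (zero Q) (sub_zero HB)) _ _ _ _ _ _ _).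
- intros S. destruct (join_lub (jimage (fun x : sub_poset B => proj1_sig x) S)) as [u l].
  split.
  + intros x Sx. apply u. exists x. auto.
  + intros v Hv. apply l. intros x [y [Sy ->]]. apply (Hv y Sy).
- intros x y z. apply sub_eq; apply plusA.
- intros x. apply sub_eq; apply plus0l.
- intros x. apply sub_eq; apply plus0r.
- intros x x' y y'. apply (plus_mono (q := Q)).
- intros S y. apply sub_eq. simpl. rewrite plus_joinl.
  transitivity (join (jimage (fun x : sub_poset B => plus (proj1_sig x) (proj1_sig y)) S)).
  + apply join_jimage_comp. reflexivity.
  + symmetry. apply join_jimage_comp. reflexivity.
- intros x S. apply sub_eq. simpl. rewrite plus_joinr.
  transitivity (join (jimage (fun y : sub_poset B => plus (proj1_sig x) (proj1_sig y)) S)).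
  + apply join_jimage_comp. reflexivity.
  + symmetry. apply join_jimage_comp. reflexivity.
Defined.

Lemma prod_order (I : Type) (X : I -> poset) :
  order (forall i, X i) (fun x y => forall i, ple (x i) (y i)).
Proof.
split.
- intros x i. apply ple_refl.
- intros x y z xy yz i. apply (ple_trans (xy i) (yz i)).
- intros x y xy yx. apply functional_extensionality_dep. intros i.
  apply ple_anti; auto.
Qed.

Definition prod_poset (I : Type) (X : I -> poset) : poset := Poset (prod_order X).

Definition prodquantale s (I : Type) (Q : I -> quantale s) : quantale s.
Proof.
refine (@Quantale s (prod_poset Q)
  (fun S i => join (jimage (fun x : prod_poset Q => x i) S))
  (fun x y i => plus (x i) (y i))
  (fun i => zero (Q i)) _ _ _ _ _ _ _).
- intros S. split.
  + intros x Sx i. apply (join_lub (jimage (fun x : prod_poset Q => x i) S)).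
    exists x. auto.
  + intros u Hu i. apply (join_lub (jimage (fun x : prod_poset Q => x i) S)).
    intros z [x [Sx ->]]. apply (Hu x Sx).
- intros x y z. apply functional_extensionality_dep. intros i. apply plusA.
- intros x. apply functional_extensionality_dep. intros i. apply plus0l.
- intros x. apply functional_extensionality_dep. intros i. apply plus0r.
- intros x x' y y' Hx Hy i. apply plus_mono; auto.
- intros S y. apply functional_extensionality_dep. intros i. rewrite plus_joinl.
  transitivity (join (jimage (fun x : prod_poset Q => plus (x i) (y i)) S)).
  + apply join_jimage_comp. reflexivity.
  + symmetry. apply join_jimage_comp. reflexivity.
- intros x S. apply functional_extensionality_dep. intros i. rewrite plus_joinr.
  transitivity (join (jimage (fun y : prod_poset Q => plus (x i) (y i)) S)).
  + apply join_jimage_comp. reflexivity.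
  + symmetry. apply join_jimage_comp. reflexivity.
Defined.

Definition qiso s (P Q : quantale s) : Prop :=
  exists (f : P -> Q) (g : Q -> P),
    is_qhom f /\ is_qhom g /\ (forall x, g (f x) = x) /\ (forall y, f (g y) = y).

Record prevariety (s : setting) (K : quantale s -> Prop) : Prop := Prevariety {
  prevar_iso : forall P Q : quantale s, qiso P Q -> K P -> K Q;
  prevar_sub : forall (Q : quantale s) (B : Q -> Prop) (HB : subclosed B),
    K Q -> K (subquantale HB);
  prevar_prod : forall (I : Type) (Q : I -> quantale s),
    (forall i, K (Q i)) -> K (prodquantale Q)
}.

Inductive mterm (V : Type) : Type :=
| MVar : V -> mterm V
| MPlus : mterm V -> mterm V -> mterm V
| MZero : mterm V.

Arguments MZero {V}.

Fixpoint meval s (Q : quantale s) (V : Type) (a : V -> Q) (m : mterm V) : Q :=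
  match m with
  | MVar v => a v
  | MPlus m1 m2 => plus (meval a m1) (meval a m2)
  | MZero => zero Q
  end.

Definition qterm (s : setting) (V : Type) := jset s (mterm V).

Definition qeval s (Q : quantale s) (V : Type) (t : qterm s V) (a : V -> Q) : Q :=
  join (jimage (meval a) t).

(* The triple (A_d, A, iota): right multiplications x |-> x * b are quantale
   homomorphisms for every b, left multiplications only for elements of A_d. *)
Record mult_quantale (s : setting) := MultQuantale {
  mq_d : pomonoid;
  mq_q :> quantale s;
  mq_mul : mq_q -> mq_q -> mq_q;
  mq_one : mq_q;
  mq_iota : mq_d -> mq_q;
  mq_mulA : forall a b c, mq_mul a (mq_mul b c) = mq_mul (mq_mul a b) c;
  mq_mul1l : forall a, mq_mul mq_one a = a;
  mq_mul1r : forall a, mq_mul a mq_one = a;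
  mq_mul_mono : forall a a' b b',
    ple a a' -> ple b b' -> ple (mq_mul a b) (mq_mul a' b');
  mq_mul_homl : forall b, is_qhom (fun a => mq_mul a b);
  mq_mul_homr : forall d, is_qhom (mq_mul (mq_iota d));
  mq_iota_emb : order_embedding mq_iota;
  mq_iota_mul : forall c d, mq_iota (pm_mul c d) = mq_mul (mq_iota c) (mq_iota d);
  mq_iota_one : mq_iota (pm_one mq_d) = mq_one
}.

Record is_module s (A : mult_quantale s) (Q : quantale s) (ast : A -> Q -> Q) : Prop :=
  IsModule {
  mod_mono : forall a a' x x', ple a a' -> ple x x' -> ple (ast a x) (ast a' x');
  mod_mul : forall a b x, ast (mq_mul a b) x = ast a (ast b x);
  mod_one : forall x, ast (mq_one A) x = x;
  mod_plus : forall a b x, ast (plus a b) x = plus (ast a x) (ast b x);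
  mod_zero : forall x, ast (zero A) x = zero Q;
  mod_join : forall (S : jset s A) x,
    ast (join S) x = join (jimage (fun a => ast a x) S);
  mod_iota : forall d : mq_d A, is_qhom (ast (mq_iota d))
}.

Record is_act s (M : pomonoid) (L : quantale s) (ast : M -> L -> L) : Prop := IsAct {
  act_mono : forall a a' x x', ple a a' -> ple x x' -> ple (ast a x) (ast a' x');
  act_mul : forall a b x, ast (pm_mul a b) x = ast a (ast b x);
  act_one : forall x, ast (pm_one M) x = x;
  act_endo : forall a, is_qhom (ast a)
}.

Record category := Category {
  obj :> Type;
  hom : obj -> obj -> Type;
  idm : forall x, hom x x;
  comp : forall x y z, hom y z -> hom x y -> hom x z;
  compA : forall x y z w (f : hom x y) (g : hom y z) (h : hom z w),
    comp h (comp g f) = comp (comp h g) f;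
  comp1l : forall x y (f : hom x y), comp (idm y) f = f;
  comp1r : forall x y (f : hom x y), comp f (idm x) = f
}.

Record functor (C D : category) := Functor {
  fobj :> C -> D;
  fmap : forall x y : C, hom x y -> hom (fobj x) (fobj y);
  fmap_id : forall x : C, fmap (idm x) = idm (fobj x);
  fmap_comp : forall (x y z : C) (g : hom y z) (f : hom x y),
    fmap (comp g f) = comp (fmap g) (fmap f)
}.

Definition idF (C : category) : functor C C :=
  @Functor C C (fun x => x) (fun _ _ f => f)
    (fun _ => eq_refl) (fun _ _ _ _ _ => eq_refl).

Definition compF (C D E : category) (G : functor D E) (F : functor C D) : functor C E.
Proof.
refine (@Functor C E (fun x => G (F x)) (fun x y f => fmap G (fmap F f)) _ _).
- intros x. rewrite !fmap_id. reflexivity.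
- intros x y z g f. rewrite !fmap_comp. reflexivity.
Defined.

(* Strict isomorphism of categories: equality of functors is Leibniz equality. *)
Definition is_cat_iso (C D : category) (F : functor C D) : Prop :=
  exists G : functor D C, compF G F = idF C /\ compF F G = idF D.

Record kmodule s (K : quantale s -> Prop) (A : mult_quantale s) := KModule {
  km_q :> quantale s;
  km_in : K km_q;
  km_ast : A -> km_q -> km_q;
  km_mod : is_module km_ast
}.

Record mod_hom s (K : quantale s -> Prop) (A : mult_quantale s) (P Q : kmodule K A) :=
  ModHom {
  mh_fun :> P -> Q;
  mh_qhom : is_qhom mh_fun;
  mh_ast : forall a x, mh_fun (km_ast a x) = km_ast a (mh_fun x)
}.

Lemma mod_hom_eq s (K : quantale s -> Prop) (A : mult_quantale s)
  (P Q : kmodule K A) (f g : mod_hom P Q) : mh_fun f = mh_fun g -> f = g.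
Proof.
destruct f as [f f1 f2], g as [g g1 g2]; simpl; intros ->.
f_equal; apply proof_irrelevance.
Qed.

Definition mod_id s (K : quantale s -> Prop) (A : mult_quantale s) (P : kmodule K A) :
  mod_hom P P := @ModHom s K A P P (fun x => x) (is_qhom_id P) (fun _ _ => eq_refl).

Definition mod_comp s (K : quantale s -> Prop) (A : mult_quantale s)
  (P Q R : kmodule K A) (g : mod_hom Q R) (f : mod_hom P Q) : mod_hom P R.
Proof.
refine (@ModHom s K A P R (fun x => g (f x)) (is_qhom_comp (mh_qhom f) (mh_qhom g)) _).
intros a x. rewrite !mh_ast. reflexivity.
Defined.

Definition ModCat s (K : quantale s -> Prop) (A : mult_quantale s) : category.
Proof.
refine (@Category (kmodule K A) (@mod_hom s K A) (@mod_id s K A) (@mod_comp s K A) _ _ _);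
  intros; apply mod_hom_eq; reflexivity.
Defined.

Record kact s (K : quantale s -> Prop) (M : pomonoid) := KAct {
  ka_q :> quantale s;
  ka_in : K ka_q;
  ka_ast : M -> ka_q -> ka_q;
  ka_act : is_act ka_ast
}.

Record act_hom s (K : quantale s -> Prop) (M : pomonoid) (P Q : kact K M) := ActHom {
  ah_fun :> P -> Q;
  ah_qhom : is_qhom ah_fun;
  ah_ast : forall a x, ah_fun (ka_ast a x) = ka_ast a (ah_fun x)
}.

Lemma act_hom_eq s (K : quantale s -> Prop) (M : pomonoid)
  (P Q : kact K M) (f g : act_hom P Q) : ah_fun f = ah_fun g -> f = g.
Proof.
destruct f as [f f1 f2], g as [g g1 g2]; simpl; intros ->.
f_equal; apply proof_irrelevance.
Qed.

Definition act_id s (K : quantale s -> Prop) (M : pomonoid) (P : kact K M) :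
  act_hom P P := @ActHom s K M P P (fun x => x) (is_qhom_id P) (fun _ _ => eq_refl).

Definition act_comp s (K : quantale s -> Prop) (M : pomonoid)
  (P Q R : kact K M) (g : act_hom Q R) (f : act_hom P Q) : act_hom P R.
Proof.
refine (@ActHom s K M P R (fun x => g (f x)) (is_qhom_comp (ah_qhom f) (ah_qhom g)) _).
intros a x. rewrite !ah_ast. reflexivity.
Defined.

Definition ActCat s (K : quantale s -> Prop) (M : pomonoid) : category.
Proof.
refine (@Category (kact K M) (@act_hom s K M) (@act_id s K M) (@act_comp s K M) _ _ _);
  intros; apply act_hom_eq; reflexivity.
Defined.

Lemma forget_is_act s (A : mult_quantale s) (Q : quantale s) (ast : A -> Q -> Q) :
  is_module ast -> is_act (fun (d : mq_d A) x => ast (mq_iota d) x).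
Proof.
intros H. split.
- intros a a' x x' Ha Hx. apply (mod_mono H); [apply mq_iota_emb|]; assumption.
- intros a b x. rewrite mq_iota_mul. apply (mod_mul H).
- intros x. rewrite mq_iota_one. apply (mod_one H).
- apply (mod_iota H).
Qed.

Definition forget_obj s (K : quantale s -> Prop) (A : mult_quantale s)
    (P : kmodule K A) : kact K (mq_d A) :=
  KAct (km_in P) (forget_is_act (km_mod P)).

Definition forget_hom s (K : quantale s -> Prop) (A : mult_quantale s)
    (P Q : kmodule K A) (f : mod_hom P Q) : act_hom (forget_obj P) (forget_obj Q) :=
  @ActHom s K (mq_d A) (forget_obj P) (forget_obj Q) (mh_fun f) (mh_qhom f)
    (fun d x => mh_ast f (mq_iota d) x).

Definition forgetful s (K : quantale s -> Prop) (A : mult_quantale s) :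
  functor (ModCat K A) (ActCat K (mq_d A)).
Proof.
refine (@Functor (ModCat K A) (ActCat K (mq_d A))
          (@forget_obj s K A) (@forget_hom s K A) _ _);
  intros; apply act_hom_eq; reflexivity.
Defined.

(* Any choice of a K-free quantale over X, given with its unit. *)
Record free_quantale s (K : quantale s -> Prop) (X : poset) := FreeQuantale {
  fq_q :> quantale s;
  fq_in : K fq_q;
  eta : X -> fq_q;
  eta_mono : order_preserving eta;
  fq_univ : forall Q : quantale s, K Q -> forall g : X -> Q, order_preserving g ->
    exists! h : fq_q -> Q, is_qhom h /\ forall x, h (eta x) = g x
}.

Arguments eta {s K X} f.

Record is_free_mul s (K : quantale s -> Prop) (M : pomonoid)
    (F : free_quantale K M) (mul : F -> F -> F) : Prop := IsFreeMul {
  fm_left : forall (V : Type) (t : qterm s V) (a : V -> F) (b : F),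
    mul (qeval t a) b = qeval t (fun v => mul (a v) b);
  fm_right : forall (V : Type) (t : qterm s V) (a : M) (b : V -> F),
    mul (eta F a) (qeval t b) = qeval t (fun v => mul (eta F a) (b v));
  fm_eta : forall a c : M, mul (eta F a) (eta F c) = eta F (pm_mul a c)
}.

Lemma is_qhom_mono s (P Q : quantale s) (f : P -> Q) : is_qhom f -> order_preserving f.
Proof.
intros Hf x y xy.
assert (adm : admissible s (fun z : P => z = x \/ z = y)).
{ destruct s; simpl; [trivial|]. exists x. auto. }
pose (S := JSet adm).
assert (E : join S = y).
{ apply join_unique. split.
  - intros z [-> | ->]; [assumption | apply ple_refl].
  - intros u Hu. apply Hu. simpl. auto. }
rewrite <- E, (qhom_join Hf). apply (join_lub (jimage f S)). exists x. simpl. auto.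
Qed.

Lemma qeval_hom s (P Q : quantale s) (f : P -> Q) :
  is_qhom f <->
  (forall (V : Type) (t : qterm s V) (a : V -> P),
     f (qeval t a) = qeval t (fun v => f (a v))).
Proof.
split.
- intros Hf V t a. unfold qeval. rewrite (qhom_join Hf).
  apply join_jimage_comp. intros m.
  induction m as [v | m1 IH1 m2 IH2 | ]; simpl.
  + reflexivity.
  + rewrite (qhom_plus Hf), IH1, IH2. reflexivity.
  + apply (qhom_zero Hf).
- intros H.
  assert (adm1 : forall V (m : mterm V), admissible s (fun z => z = m)).
  { intros V m. destruct s; simpl; eauto. }
  assert (ev1 : forall (R : quantale s) V (m : mterm V) (a : V -> R),
            qeval (JSet (adm1 V m)) a = meval a m).
  { intros R V m a. apply join_unique. split.
    - intros x [z [-> ->]]. apply ple_refl.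
    - intros u Hu. apply Hu. exists m. simpl. auto. }
  split.
  + intros S.
    assert (E : forall (R : quantale s) (a : P -> R),
               qeval (jimage (@MVar P) S) a = join (jimage a S)).
    { intros R a. apply join_jimage_comp. reflexivity. }
    specialize (H P (jimage (@MVar P) S) (fun x => x)). rewrite !E in H.
    transitivity (f (join (jimage (fun x => x) S))); [|exact H].
    f_equal. apply (qhom_join (is_qhom_id P)).
  + intros x y.
    specialize (H bool (JSet (adm1 _ (MPlus (MVar true) (MVar false))))
                  (fun b : bool => if b then x else y)).
    rewrite !ev1 in H. exact H.
  + specialize (H bool (JSet (adm1 _ MZero)) (fun b : bool => zero P)).
    rewrite !ev1 in H. exact H.
Qed.

Lemma fq_ext s (K : quantale s -> Prop) (X : poset) (F : free_quantale K X)
    (Q : quantale s) (KQ : K Q) (f g : F -> Q) :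
  is_qhom f -> is_qhom g -> (forall x, f (eta F x) = g (eta F x)) ->
  forall a, f a = g a.
Proof.
intros Hf Hg E a.
destruct (fq_univ F KQ (g := fun x => f (eta F x))) as [h [_ U]].
- intros x y xy. apply (is_qhom_mono Hf), eta_mono, xy.
- rewrite <- (U f (conj Hf (fun _ => eq_refl))).
  rewrite <- (U g (conj Hg (fun x => eq_sym (E x)))). reflexivity.
Qed.

Lemma fq_ind s (K : quantale s -> Prop) (HK : prevariety K) (X : poset)
    (F : free_quantale K X) (B : F -> Prop) :
  subclosed B -> (forall x, B (eta F x)) -> forall a, B a.
Proof.
intros HB Heta a.
destruct (fq_univ F (prevar_sub HK HB (fq_in F))
            (g := fun x => exist B (eta F x) (Heta x))) as [h [[Hh Eh] _]].
- intros x y xy. apply (eta_mono F), xy.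
- assert (Hp : is_qhom (P := subquantale HB) (Q := F)
                 (fun x : sub_poset B => proj1_sig x)) by (split; reflexivity).
  rewrite <- (fq_ext (fq_in F) (is_qhom_comp Hh Hp) (is_qhom_id F)).
  + apply proj2_sig.
  + intros x. rewrite Eh. reflexivity.
Qed.

Lemma le_hom_subclosed s (P Q : quantale s) (f g : P -> Q) :
  is_qhom f -> is_qhom g -> subclosed (fun x => ple (f x) (g x)).
Proof.
intros Hf Hg. split.
- intros S HS. rewrite (qhom_join Hf), (qhom_join Hg).
  apply (join_lub (jimage f S)). intros z [x [Sx ->]].
  apply (ple_trans (HS x Sx)). apply (join_lub (jimage g S)). exists x. auto.
- intros x y Hx Hy. rewrite (qhom_plus Hf), (qhom_plus Hg). apply plus_mono; assumption.
- rewrite (qhom_zero Hf), (qhom_zero Hg). apply ple_refl.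
Qed.

Section FreeMul.
Context (s : setting) (K : quantale s -> Prop) (HK : prevariety K) (M : pomonoid)
  (F : free_quantale K M).

Lemma fm_homl mul (H : is_free_mul (F := F) mul) b : is_qhom (fun a => mul a b).
Proof. apply qeval_hom. intros. apply (fm_left H). Qed.

Lemma fm_homr mul (H : is_free_mul (F := F) mul) a : is_qhom (mul (eta F a)).
Proof. apply qeval_hom. intros. apply (fm_right H). Qed.

Lemma fm_mulA mul (H : is_free_mul (F := F) mul) a b c :
  mul a (mul b c) = mul (mul a b) c.
Proof.
apply (fq_ext (fq_in F) (f := fun a => mul a (mul b c)) (g := fun a => mul (mul a b) c)).
- apply (fm_homl H).
- apply (is_qhom_comp (fm_homl H b) (fm_homl H c)).
- intros m.
  apply (fq_ext (fq_in F) (f := fun b => mul (eta F m) (mul b c))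
           (g := fun b => mul (mul (eta F m) b) c)).
  + apply (is_qhom_comp (fm_homl H c) (fm_homr H m)).
  + apply (is_qhom_comp (fm_homr H m) (fm_homl H c)).
  + intros n.
    apply (fq_ext (fq_in F) (f := fun c => mul (eta F m) (mul (eta F n) c))
             (g := fun c => mul (mul (eta F m) (eta F n)) c)).
    * apply (is_qhom_comp (fm_homr H n) (fm_homr H m)).
    * rewrite (fm_eta H). apply (fm_homr H).
    * intros k. rewrite !(fm_eta H), pm_mulA. reflexivity.
Qed.

Lemma fm_mul1l mul (H : is_free_mul (F := F) mul) a : mul (eta F (pm_one M)) a = a.
Proof.
apply (fq_ext (fq_in F) (f := mul (eta F (pm_one M))) (g := fun a => a)).
- apply (fm_homr H).
- apply is_qhom_id.
- intros m. rewrite (fm_eta H), pm_mul1l. reflexivity.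
Qed.

Lemma fm_mul1r mul (H : is_free_mul (F := F) mul) a : mul a (eta F (pm_one M)) = a.
Proof.
apply (fq_ext (fq_in F) (f := fun a => mul a (eta F (pm_one M))) (g := fun a => a)).
- apply (fm_homl H).
- apply is_qhom_id.
- intros m. rewrite (fm_eta H), pm_mul1r. reflexivity.
Qed.

Lemma fm_mul_mono mul (H : is_free_mul (F := F) mul) a a' b b' :
  ple a a' -> ple b b' -> ple (mul a b) (mul a' b').
Proof.
intros Ha Hb. apply (ple_trans (is_qhom_mono (fm_homl H b) Ha)).
apply (fq_ind HK (B := fun a => ple (mul a b) (mul a b'))).
- apply (le_hom_subclosed (fm_homl H b) (fm_homl H b')).
- intros m. apply (is_qhom_mono (fm_homr H m) Hb).
Qed.

(* is_free_mul is a definite description: it singles out the multiplication of F_K(M). *)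
Lemma free_mul_exists_unique : exists! mul : F -> F -> F, is_free_mul mul.
Proof.
assert (mono1 : forall m : M, order_preserving (fun n => eta F (pm_mul m n))).
{ intros m x y xy. apply eta_mono, pm_mul_mono; [apply ple_refl | exact xy]. }
pose (l := fun m => proj1_sig (constructive_indefinite_description _
                      (fq_univ F (fq_in F) (mono1 m)))).
assert (Hl : forall m, is_qhom (l m) /\ forall n, l m (eta F n) = eta F (pm_mul m n)).
{ intros m. apply (proj1 (proj2_sig (constructive_indefinite_description _
                     (fq_univ F (fq_in F) (mono1 m))))). }
assert (mono2 : forall b : F, order_preserving (fun m => l m b)).
{ intros b x y xy. apply (fq_ind HK (B := fun b => ple (l x b) (l y b))).
  - apply le_hom_subclosed; apply Hl.
  - intros n. rewrite !(proj2 (Hl _)).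
    apply eta_mono, pm_mul_mono; [exact xy | apply ple_refl]. }
pose (r := fun b => proj1_sig (constructive_indefinite_description _
                      (fq_univ F (fq_in F) (mono2 b)))).
assert (Hr : forall b, is_qhom (r b) /\ forall m, r b (eta F m) = l m b).
{ intros b. apply (proj1 (proj2_sig (constructive_indefinite_description _
                     (fq_univ F (fq_in F) (mono2 b))))). }
exists (fun a b => r b a). split.
- split.
  + intros V t a b. apply (proj1 (qeval_hom (r b)) (proj1 (Hr b))).
  + intros V t a b. rewrite (proj2 (Hr _)).
    rewrite (proj1 (qeval_hom (l a)) (proj1 (Hl a))).
    f_equal. apply functional_extensionality. intros v.
    rewrite (proj2 (Hr _)). reflexivity.
  + intros a c. rewrite (proj2 (Hr _)). apply Hl.
- intros mul H. apply functional_extensionality. intros a.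
  apply functional_extensionality. intros b.
  apply (fq_ext (fq_in F) (f := r b) (g := fun a => mul a b)).
  + apply Hr.
  + apply (fm_homl H).
  + intros m. rewrite (proj2 (Hr _)).
    apply (fq_ext (fq_in F) (f := l m) (g := mul (eta F m))).
    * apply Hl.
    * apply (fm_homr H).
    * intros n. rewrite (proj2 (Hl _)), (fm_eta H). reflexivity.
Qed.

End FreeMul.

(* F_K(M) = (M, F_K(M), eta_M), with unit eta_M(1). *)
Definition free_mult_quantale s (K : quantale s -> Prop) (HK : prevariety K)
    (M : pomonoid) (F : free_quantale K M) (mul : F -> F -> F)
    (Hmul : is_free_mul mul) (Heta : order_embedding (eta F)) : mult_quantale s :=
  @MultQuantale s M F mul (eta F (pm_one M)) (eta F)
    (fm_mulA Hmul) (fm_mul1l Hmul) (fm_mul1r Hmul) (fm_mul_mono HK Hmul)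
    (fm_homl Hmul) (fm_homr Hmul) Heta
    (fun c d => eq_sym (fm_eta Hmul c d)) eq_refl.

(* Main.v *)
From Stdlib Require Import FunctionalExtensionality ProofIrrelevance ClassicalEpsilon.
Require Import Defs.

(** For a fixed element [x] of an act [L] in [K], the monotone map
    [m |-> star m x] extends uniquely to a homomorphism [F -> L]; its value at
    [a] is the only possible choice for [a * x].  Every module law is then an
    equality, or an inequality, between homomorphisms out of [F], so it suffices
    to check it on the generators [eta m], where it is an act law. *)

Set Implicit Arguments.
Unset Strict Implicit.
Unset Printing Implicit Defensive.

(* Comparing morphisms together with their endpoints avoids transport along
   [F x = G x]. *)
Lemma functor_eq (C D : category) (F G : functor C D) :
  (forall (x y : C) (f : hom x y),
     existT (fun p : D * D => hom (fst p) (snd p)) (F x, F y) (fmap F f) =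
     existT (fun p : D * D => hom (fst p) (snd p)) (G x, G y) (fmap G f)) ->
  F = G.
Proof.
destruct F as [F F2 F3 F4], G as [G G2 G3 G4]; simpl; intros E.
assert (FG : F = G).
{ apply functional_extensionality. intros x.
  exact (f_equal (fun u => fst (projT1 u)) (E x x (idm x))). }
subst G.
assert (FG2 : F2 = G2).
{ do 3 (apply functional_extensionality_dep; intros ?).
  exact (inj_pair2 _ _ _ _ _ (E _ _ _)). }
subst G2. f_equal; apply proof_irrelevance.
Qed.

(** The endpoints of [f'] are [P] and [Q] with their actions replaced by variables, so the equations
    between actions can be substituted. The law proofs then agree by proof irrelevance, and the
    endpoints coincide. *)
Lemma mod_hom_existT_eq s (K : quantale s -> Prop) (A : mult_quantale s)
    (P Q : kmodule K A) (a : A -> P -> P) (Ha : is_module a)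
    (b : A -> Q -> Q) (Hb : is_module b)
    (f' : mod_hom (KModule (km_in P) Ha) (KModule (km_in Q) Hb)) (f : mod_hom P Q) :
  a = km_ast (k := P) -> b = km_ast (k := Q) -> mh_fun f' = mh_fun f ->
  existT (fun p : kmodule K A * kmodule K A => mod_hom (fst p) (snd p)) (_, _) f' =
  existT (fun p : kmodule K A * kmodule K A => mod_hom (fst p) (snd p)) (P, Q) f.
Proof.
destruct P as [P KP aP HP], Q as [Q KQ aQ HQ]; simpl in *; intros -> -> E.
destruct (proof_irrelevance _ HP Ha), (proof_irrelevance _ HQ Hb).
f_equal. apply mod_hom_eq, E.
Qed.

Lemma act_hom_existT_eq s (K : quantale s -> Prop) (M : pomonoid)
    (P Q : kact K M) (a : M -> P -> P) (Ha : is_act a)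
    (b : M -> Q -> Q) (Hb : is_act b)
    (f' : act_hom (KAct (ka_in P) Ha) (KAct (ka_in Q) Hb)) (f : act_hom P Q) :
  a = ka_ast (k := P) -> b = ka_ast (k := Q) -> ah_fun f' = ah_fun f ->
  existT (fun p : kact K M * kact K M => act_hom (fst p) (snd p)) (_, _) f' =
  existT (fun p : kact K M * kact K M => act_hom (fst p) (snd p)) (P, Q) f.
Proof.
destruct P as [P KP aP HP], Q as [Q KQ aQ HQ]; simpl in *; intros -> -> E.
destruct (proof_irrelevance _ HP Ha), (proof_irrelevance _ HQ Hb).
f_equal. apply act_hom_eq, E.
Qed.

(** This form of the scalar laws lets [fq_ext] compare two actions. *)
Lemma module_qhom s (A : mult_quantale s) (Q : quantale s) (ast : A -> Q -> Q) :
  is_module ast -> forall x, is_qhom (fun a => ast a x).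
Proof.
intros H x. split.
- intros S. apply (mod_join H).
- intros a b. apply (mod_plus H).
- apply (mod_zero H).
Qed.

Lemma act_orbit_mono s (M : pomonoid) (L : quantale s) (star : M -> L -> L) :
  is_act star -> forall x, order_preserving (fun m => star m x).
Proof. intros H x m n mn. apply (act_mono H mn), ple_refl. Qed.

Section Expansion.
Context (s : setting) (K : quantale s -> Prop) (M : pomonoid) (F : free_quantale K M).

(** The universal property only asserts existence, so the extension is picked by indefinite
    description. *)
Definition act_expansion (L : quantale s) (KL : K L) (star : M -> L -> L)
    (Hstar : is_act star) (a : F) (x : L) : L :=
  proj1_sig (constructive_indefinite_description _
               (fq_univ F KL (act_orbit_mono Hstar x))) a.

Lemma act_expansion_spec (L : quantale s) (KL : K L) (star : M -> L -> L)
    (Hstar : is_act star) x :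
  is_qhom (fun a => act_expansion KL Hstar a x) /\
  forall m, act_expansion KL Hstar (eta F m) x = star m x.
Proof.
exact (proj1 (proj2_sig (constructive_indefinite_description _
                           (fq_univ F KL (act_orbit_mono Hstar x))))).
Qed.

Lemma act_expansion_qhom (L : quantale s) (KL : K L) (star : M -> L -> L)
    (Hstar : is_act star) x :
  is_qhom (fun a => act_expansion KL Hstar a x).
Proof. apply act_expansion_spec. Qed.

Lemma act_expansion_eta (L : quantale s) (KL : K L) (star : M -> L -> L)
    (Hstar : is_act star) m x :
  act_expansion KL Hstar (eta F m) x = star m x.
Proof. apply act_expansion_spec. Qed.

(** Both sides are homomorphisms in [a] that agree on generators because [f] commutes with the acts.
    Hence every act morphism is already a module morphism. *)
Lemma act_expansion_hom (P Q : kact K M) (f : act_hom P Q) a x :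
  f (act_expansion (ka_in P) (ka_act P) a x) =
  act_expansion (ka_in Q) (ka_act Q) a (f x).
Proof.
apply (fq_ext (ka_in Q)
         (f := fun a => f (act_expansion (ka_in P) (ka_act P) a x))
         (g := fun a => act_expansion (ka_in Q) (ka_act Q) a (f x))).
- apply (is_qhom_comp (act_expansion_qhom _ _ x) (ah_qhom f)).
- apply act_expansion_qhom.
- intros m. rewrite !act_expansion_eta. apply ah_ast.
Qed.

Context (HK : prevariety K) (mul : F -> F -> F) (Hmul : is_free_mul mul)
  (Heta : order_embedding (eta F)).
Let FM := free_mult_quantale HK Hmul Heta.

(** Freeness is applied first in [a], then in [b], which reduces the claim to associativity of the
    act. *)
Lemma act_expansion_mul (L : quantale s) (KL : K L) (star : M -> L -> L)
    (Hstar : is_act star) a b x :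
  act_expansion KL Hstar (mul a b) x =
  act_expansion KL Hstar a (act_expansion KL Hstar b x).
Proof.
apply (fq_ext KL (f := fun a => act_expansion KL Hstar (mul a b) x)
         (g := fun a => act_expansion KL Hstar a (act_expansion KL Hstar b x))).
- apply (is_qhom_comp (fm_homl Hmul b) (act_expansion_qhom KL Hstar x)).
- apply act_expansion_qhom.
- intros m. rewrite act_expansion_eta.
  (* Reducing [b] has to wait until [a] is a generator: [fm_homr] and [act_endo] give homomorphisms
     only for left factors coming from [M]. *)
  apply (fq_ext KL (f := fun b => act_expansion KL Hstar (mul (eta F m) b) x)
           (g := fun b => star m (act_expansion KL Hstar b x))).
  + apply (is_qhom_comp (fm_homr Hmul m) (act_expansion_qhom KL Hstar x)).
  + apply (is_qhom_comp (act_expansion_qhom KL Hstar x) (act_endo Hstar m)).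
  + intros n. rewrite (fm_eta Hmul), !act_expansion_eta. apply (act_mul Hstar).
Qed.

Lemma act_expansion_module (L : quantale s) (KL : K L) (star : M -> L -> L)
    (Hstar : is_act star) :
  is_module (A := FM) (act_expansion KL Hstar).
Proof.
split.
- intros a a' x x' Ha Hx.
  apply (ple_trans (is_qhom_mono (act_expansion_qhom KL Hstar x) Ha)).
  (* Monotonicity in [x] is an inequality, so uniqueness of extensions does not settle it. The
     scalars satisfying it form a subquantale containing the generators, hence all of [F]. *)
  apply (fq_ind HK (B := fun a => ple (act_expansion KL Hstar a x)
                                      (act_expansion KL Hstar a x'))).
  + apply le_hom_subclosed; apply act_expansion_qhom.
  + intros m. rewrite !act_expansion_eta. apply (act_mono Hstar (ple_refl m) Hx).
- apply act_expansion_mul.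
- intros x. simpl. rewrite act_expansion_eta. apply (act_one Hstar).
- intros a b x. apply (qhom_plus (act_expansion_qhom KL Hstar x)).
- intros x. apply (qhom_zero (act_expansion_qhom KL Hstar x)).
- intros S x. apply (qhom_join (act_expansion_qhom KL Hstar x)).
- intros d. simpl.
  replace (act_expansion KL Hstar (eta F d)) with (star d).
  + apply (act_endo Hstar).
  + apply functional_extensionality. intros x. symmetry. apply act_expansion_eta.
Qed.

(** For fixed [x] both actions are homomorphisms out of [F], so the generators determine them. This
    gives uniqueness of the expansion and one of the two round trips. *)
Lemma module_ext (L : quantale s) (KL : K L) (ast ast' : F -> L -> L) :
  is_module (A := FM) ast -> is_module (A := FM) ast' ->
  (forall m x, ast (eta F m) x = ast' (eta F m) x) -> ast = ast'.
Proof.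
intros H H' E. do 2 (apply functional_extensionality; intros ?).
apply (fq_ext KL (module_qhom H _) (module_qhom H' _)). intros m. apply E.
Qed.

Definition expansion_obj (P : kact K M) : kmodule K FM :=
  KModule (ka_in P) (act_expansion_module (ka_in P) (ka_act P)).

Definition expansion_hom (P Q : kact K M) (f : act_hom P Q) :
    mod_hom (expansion_obj P) (expansion_obj Q) :=
  @ModHom s K FM (expansion_obj P) (expansion_obj Q) (ah_fun f) (ah_qhom f)
    (act_expansion_hom f).

Definition expansion : functor (ActCat K M) (ModCat K FM).
Proof.
refine (@Functor (ActCat K M) (ModCat K FM) expansion_obj expansion_hom _ _);
  intros; apply mod_hom_eq; reflexivity.
Defined.

Lemma expansion_forget_ast (P : kmodule K FM) :
  km_ast (k := expansion_obj (forget_obj P)) = km_ast (k := P).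
Proof.
apply (module_ext (km_in P)).
- apply act_expansion_module.
- apply km_mod.
- intros m x. apply act_expansion_eta.
Qed.

Lemma forget_expansion_ast (P : kact K M) :
  ka_ast (k := forget_obj (expansion_obj P)) = ka_ast (k := P).
Proof. do 2 (apply functional_extensionality; intros ?). apply act_expansion_eta. Qed.

Lemma forgetful_iso : is_cat_iso (forgetful K FM).
Proof.
exists expansion. split; apply functor_eq; intros P Q f.
(* Both functors keep the quantales and the underlying functions, so only the actions at the two
   endpoints need comparing. *)
- apply (mod_hom_existT_eq (f' := expansion_hom (forget_hom f)) (f := f)).
  + apply expansion_forget_ast.
  + apply expansion_forget_ast.
  + reflexivity.
- apply (act_hom_existT_eq (f' := forget_hom (expansion_hom f)) (f := f)).
  + apply forget_expansion_ast.
  + apply forget_expansion_ast.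
  + reflexivity.
Qed.

End Expansion.

Theorem theorem4p2 (s : setting) (K : quantale s -> Prop) (HK : prevariety K)
    (M : pomonoid) (F : free_quantale K M)
    (mul : F -> F -> F) (Hmul : is_free_mul mul)
    (Heta : order_embedding (eta F)) :
  is_cat_iso (forgetful K (free_mult_quantale HK Hmul Heta)) /\
  (forall (L : quantale s) (star : M -> L -> L), K L -> is_act star ->
     exists! ast : F -> L -> L,
       is_module (A := free_mult_quantale HK Hmul Heta) ast /\
       (forall (a : M) (x : L), ast (eta F a) x = star a x)).
Proof.
split; [apply forgetful_iso|].
intros L star KL Hstar. exists (act_expansion KL Hstar). split.
- split; [apply act_expansion_module | apply act_expansion_eta].
- intros ast [Hast E]. apply (module_ext KL (act_expansion_module _ _ _ KL Hstar) Hast).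
  intros m x. rewrite E. apply act_expansion_eta.
Qed.
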